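(* If $G$ is a connected $3$-regular graph with second largest eigenvalue $\lambda_2(G)\le 1.9$, then $|V(G)|\le 18$, with equality if and only if $G$ is (isomorphic to) the Pappus graph or the graph $Y$ described in the context.
   Context: Graphs are finite and simple. $\lambda_2(G)$ is the second largest eigenvalue of the adjacency matrix of $G$. The Pappus graph is the point-line incidence graph of the Pappus configuration; it is the $3$-regular graph on $18$ vertices with LCF notation $[5,7,-7,7,-7,-5]^3$, and its second largest eigenvalue is $\sqrt3$. The graph $Y$ is the following connected $3$-regular graph on $18$ vertices. Its vertices are $c_1,c_2,c_3$ together with $p_i,q_i,r_i,y_i,z_i$ for $i\in\mathbb{Z}/3\mathbb{Z}$. Its edges are, for every $i\in\mathbb{Z}/3\mathbb{Z}$: $c_1p_i$, $c_2q_i$, $c_3r_i$, $p_ir_i$, $q_ir_i$, $p_iy_i$, $q_iz_i$, $y_iz_{i+1}$, $y_iz_{i-1}$. The second largest eigenvalue of $Y$ is $\gamma\approx1.8662$, the largest root of $f(x)=x^3+2x^2-4x-6$. *)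

(* Defs.v *)
From HB Require Import structures.
From mathcomp Require Import all_boot all_order all_algebra.
From mathcomp Require Import polyrcf.

Set Implicit Arguments.
Unset Strict Implicit.
Unset Printing Implicit Defensive.

Import Order.TTheory GRing.Theory Num.Theory.
Local Open Scope ring_scope.

(* A finite simple graph is a symmetric irreflexive relation on a finType. *)

Definition connected_graph (T : finType) (e : rel T) : Prop :=
  (0 < #|T|)%N /\ forall x y : T, connect e x y.

Definition regular_graph (k : nat) (T : finType) (e : rel T) : Prop :=
  forall x : T, #|[set y | e x y]| = k.

Definition graph_iso (T U : finType) (e : rel T) (e' : rel U) : Prop :=
  exists f : T -> U, bijective f /\ forall x y : T, e' (f x) (f y) = e x y.

Definition adjacency_mx (R : nzRingType) (T : finType) (e : rel T) :
    'M[R]_(#|T|) :=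
  \matrix_(i, j) (e (enum_val i) (enum_val j))%:R.

(* The eigenvalues lying in R, in nonincreasing order, each repeated according
   to its multiplicity as a root of the characteristic polynomial.  For a
   symmetric matrix these are all n eigenvalues. *)
Definition spectrum (R : rcfType) (n : nat) (A : 'M[R]_n) : seq R :=
  sort (fun x y => y <= x)
    (flatten [seq nseq (mup x (char_poly A)) x | x <- rootsR (char_poly A)]).

(* Counting from 0, the entry of index 1 is the second largest eigenvalue.
   The default 0 is only returned on graphs with fewer than two vertices. *)
Definition lambda2 (R : rcfType) (T : finType) (e : rel T) : R :=
  (spectrum (adjacency_mx R e))`_1.

(* LCF notation: on Z/n with n = size s > 1, the Hamiltonian cycle i ~ i + 1
   together with the chords i ~ i + s_i. *)
Definition lcf_rel (s : seq int) : rel 'Z_(size s) := fun i j =>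
  [|| j == i + 1, i == j + 1, j == i + (s`_i)%:~R | i == j + (s`_j)%:~R].

Definition pappus_code : seq int := flatten (nseq 3 [:: 5; 7; -7; 7; -7; -5]).

Definition pappus_rel : rel 'Z_(size pappus_code) :=
  @lcf_rel pappus_code.

Inductive Yvertex : Type :=
  | Yc1 | Yc2 | Yc3
  | Yp of 'Z_3 | Yq of 'Z_3 | Yr of 'Z_3 | Yy of 'Z_3 | Yz of 'Z_3.

Definition Yvertex_code (v : Yvertex) : 'I_3 + 'I_5 * 'Z_3 :=
  match v with
  | Yc1 => inl (inord 0) | Yc2 => inl (inord 1) | Yc3 => inl (inord 2)
  | Yp i => inr (inord 0, i) | Yq i => inr (inord 1, i)
  | Yr i => inr (inord 2, i) | Yy i => inr (inord 3, i)
  | Yz i => inr (inord 4, i)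
  end.

Definition Yvertex_decode (c : 'I_3 + 'I_5 * 'Z_3) : Yvertex :=
  match c with
  | inl k => nth Yc1 [:: Yc1; Yc2; Yc3] k
  | inr (k, i) => nth Yc1 [:: Yp i; Yq i; Yr i; Yy i; Yz i] k
  end.

Lemma Yvertex_codeK : cancel Yvertex_code Yvertex_decode.
Proof. by case=> [|||i|i|i|i|i]; rewrite /= inordK. Qed.

HB.instance Definition _ := Finite.copy Yvertex (can_type Yvertex_codeK).

Definition Y_edge (u v : Yvertex) : bool :=
  match u, v with
  | Yc1, Yp _ | Yc2, Yq _ | Yc3, Yr _ => true
  | Yp i, Yr j | Yq i, Yr j | Yp i, Yy j | Yq i, Yz j => i == j
  | Yy i, Yz j => (j == i + 1) || (j == i - 1)
  | _, _ => false
  end.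

Definition Y_rel : rel Yvertex := fun u v => Y_edge u v || Y_edge v u.

(* Main.v *)
From Stdlib Require Import NArith.
Require Import Defs.
From mathcomp Require Import all_boot all_order all_algebra.
From mathcomp Require Import polyrcf complex sesquilinear spectral.
From mathcomp Require Import zify ring lra.
Import Order.TTheory GRing.Theory Num.Theory.
Set Implicit Arguments.
Unset Strict Implicit.
Unset Printing Implicit Defensive.

(** Let A be the adjacency matrix of a cubic graph on n vertices.  As A has at
    most one eigenvalue above 1.9, and the all-ones vector already provides the
    eigenvalue 3, the quadratic form of A is at most 1.9 |v|^2 on the vectors
    orthogonal to the all-ones vector.  Projecting an arbitrary vector Y gives

      Y A Y^T <= 1.9 |Y|^2 + (1.1 / n) (sum of Y)^2,

    and this inequality, for Y with natural number entries (predicate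
    [expanding]), is all that is used of the spectrum.

    The inequality is a local obstruction.  If a subgraph H of G is known and Y
    is nonnegative and supported on H, then the edges of H alone bound Y A Y^T
    from below, whatever the other edges of G are; and the right-hand side
    decreases with n, so that n may be replaced by any lower bound.  Hence a
    vector on H that breaks the inequality with n = max(18, |H|) excludes H from
    every admissible graph on at least 18 vertices
    ([expanding_not_violated]).  A piece that is large or rich in short
    cycles tends to have such a vector, close to a top eigenvector of
    A_H - (1.1 / n) J, which power iteration finds.

    One can therefore grow all the admissible graphs from a small starting
    piece, one edge at a time, and discard each piece that has such a vector
    ([search], with soundness [search_sound]).  Starting from the triangle, the
    square and the pentagon this discards everything, so that the girth is at
    least 6; starting from a single vertex with girth at least 7 it again
    discards everything; starting from a hexagon, the pieces that survive until
    they are closed are all copies of the Pappus graph or of Y.  By connectedness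
    a closed piece is the whole graph, so that an admissible graph on at least 18
    vertices is one of these two, and in particular has exactly 18 vertices. *)

(** * The second eigenvalue and quadratic forms *)

Local Open Scope ring_scope.

Lemma char_poly_conj (F : fieldType) n (Q D : 'M[F]_n) :
  Q \in unitmx -> char_poly (invmx Q *m D *m Q) = char_poly D.
Proof.
move=> Qu; rewrite /char_poly.
set q := map_mx (@polyC F) Q; set q' := map_mx (@polyC F) (invmx Q).
have q'q : q' *m q = 1%:M by rewrite -map_mxM mulVmx // map_mx1.
have -> : char_poly_mx (invmx Q *m D *m Q) = q' *m char_poly_mx D *m q.
  rewrite /char_poly_mx !map_mxM mulmxBr mulmxBl; congr (_ - _).
  by rewrite scalar_mxC -mulmxA q'q mulmx1.
by rewrite !det_mulmx mulrAC -det_mulmx q'q det1 mul1r.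
Qed.

(** The list of the roots of the characteristic polynomial repeated according to
    their multiplicities is determined by its counting function, which can be
    read off any splitting into linear factors. *)
Lemma perm_spectrum (R : rcfType) n (A : 'M[R]_n) (rs : seq R) :
  char_poly A = \prod_(x <- rs) ('X - x%:P) -> perm_eq (spectrum A) rs.
Proof.
move=> charE; rewrite perm_sort; apply/allP => x _ /=; apply/eqP.
have p_neq0 : char_poly A != 0 by apply/monic_neq0/char_poly_monic.
have -> : count_mem x rs = mup x (char_poly A) by rewrite charE mu_prod_XsubC.
rewrite count_flatten -map_comp.
rewrite (@eq_map _ _ _ (fun y => mup x (char_poly A) * (y == x))%N); last first.
  by move=> y /=; rewrite count_nseq mulnC /=; case: eqP => [->|]; rewrite ?muln0.
have sum_eq (s : seq R) : (\sum_(y <- s) (y == x) = count_mem x s)%N.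
  by rewrite -sum1_count [RHS]big_mkcond; apply: eq_bigr => y _ /=; case: eqP.
rewrite sumnE big_map -big_distrr /= sum_eq count_uniq_mem ?uniq_roots //.
case: (boolP (x \in _)) => [_|]; first by rewrite muln1.
have := roots_onP (roots_on_rootsR p_neq0) (x := x).
rewrite in_itv /= => /(_ isT) <- /mupNroot ->.
by rewrite muln0.
Qed.

Lemma at_most_one_gt_lambda2 (R : rcfType) n (A : 'M[R]_n) (r : 'I_n -> R) (c : R) :
  char_poly A = \prod_i ('X - (r i)%:P) -> (spectrum A)`_1 <= c ->
  forall i j, c < r i -> c < r j -> i = j.
Proof.
move=> charE le_c; pose rs := codom r.
have /perm_spectrum perm_rs : char_poly A = \prod_(x <- rs) ('X - x%:P).
  by rewrite charE /rs codomE big_map -big_enum.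
suff : (#|[pred i | (c < r i)%R]| <= 1)%N by move=> /card_le1_eqP h i j ci cj; apply: h.
have -> : #|[pred i | (c < r i)%R]| = count (fun x => c < x) rs.
  by rewrite /rs codomE count_map cardE size_filter enumT.
rewrite -(permP perm_rs).
have : sorted (fun x y => y <= x) (spectrum A).
  by apply: sort_sorted => x y; apply: le_total.
case: (spectrum A) le_c => [//|x [|y s]] /= le_c; first by rewrite addn0 leq_b1.
case/andP => _ path_s; rewrite [c < y]ltNge le_c add0n.
rewrite -[count _ s]size_filter.
suff -> : [seq z <- s | c < z] = [::] by rewrite addn0 leq_b1.
apply/eqP; rewrite -[_ == _]negbK -has_filter; apply/hasPn => z zs.
rewrite -leNgt; apply: le_trans le_c.
have ge_trans : transitive (fun a b : R => b <= a).
  by move=> b a d ba db; apply: le_trans ba.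
by have /allP := order_path_min ge_trans path_s; apply.
Qed.

(** The eigenbasis is only claimed over the complex extension R[i], where the
    spectral theorem for normal matrices provides a unitary one; the
    eigenvalues are real because the matrix is hermitian. *)
Lemma sym_spectral (R : rcfType) n (A : 'M[R]_n) : A^T = A ->
  exists2 r : 'I_n -> R, char_poly A = \prod_i ('X - (r i)%:P) &
  exists2 P : 'M[R[i]]_n, P \is unitarymx &
    map_mx (real_complex R) A =
      (P ^t* *m diag_mx (\row_i (real_complex R (r i))) *m P)%sesqui.
Proof.
move=> symA; set A' := map_mx _ A.
have realA' : A' \is a mxOver Num.real.
  by apply/mxOverP => i j; rewrite mxE; apply/complex_realP; eexists.
have hermA : A' \is hermsymmx.
  apply: realsym_hermsym => //; apply/is_hermitianmxP.
  by rewrite expr0 scale1r map_mx_id // {2}/A' map_trmx symA.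
pose d := spectral_diag A'; pose r i := complex.Re (d 0 i).
have dE : \row_i real_complex R (r i) = d.
  apply/rowP => i; rewrite mxE RRe_real //.
  by have /mxOverP := hermitian_spectral_diag_real hermA; apply.
have AE := orthomx_spectralP (hermitian_normalmx hermA).
exists r; last exists (spectralmx A'); rewrite ?spectral_unitarymx //.
  apply: (map_poly_inj (real_complex R)); rewrite map_char_poly -/A' AE.
  rewrite char_poly_conj ?spectral_unit // char_poly_trig ?diag_mx_is_trig //.
  rewrite rmorph_prod; apply: eq_bigr => i _.
  by rewrite rmorphB /= map_polyX map_polyC -/d -dE !mxE eqxx mulr1n.
by rewrite dE -invmx_unitary ?spectral_unitarymx.
Qed.


(** In a unitary eigenbasis the all-ones vector has nonzero coordinates only on
    eigenvalues equal to k, and k > c leaves room for a single one.  A vector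
    orthogonal to it thus has no coordinate there, and all the other eigenvalues
    are at most c. *)
Lemma lambda2_quadratic (R : rcfType) n (A : 'M[R]_n) (k c : R) :
    A^T = A -> const_mx 1 *m A = k *: const_mx 1 :> 'rV_n ->
    c < k -> (spectrum A)`_1 <= c ->
  forall v : 'rV[R]_n, v *m (const_mx 1 : 'cV_n) = 0 ->
    (v *m A *m v^T) 0 0 <= c * (v *m v^T) 0 0.
Proof.
move=> symA A1 ck lam v v1.
have [r charE [P Punit AE]] := sym_spectral symA.
have uniq_gt := at_most_one_gt_lambda2 charE lam.
pose C := R[i]; pose toC : R -> C := real_complex R.
pose coords (w : 'rV[R]_n) : 'rV[C]_n := (map_mx (real_complex R) w *m P^t*)%sesqui.
have conjC m p (M : 'M[R]_(m, p)) : (map_mx toC M ^t*)%sesqui = map_mx toC M^T.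
  by apply/matrixP => i j; rewrite !mxE; apply: conjc_real.
have dotE (w w' : 'rV[R]_n) :
    toC ((w *m w'^T) 0 0) = \sum_i coords w 0 i * (coords w' 0 i)^*.
  transitivity ((coords w *m (coords w') ^t*)%sesqui 0 0); last first.
    by rewrite mxE; apply: eq_bigr => i _; rewrite !mxE.
  rewrite /coords trmx_mul map_mxM trmxCK mulmxA mulmxKtV // conjC.
  by rewrite -map_mxM [RHS]mxE.
have PPt : (P *m P^t*)%sesqui = 1%:M by apply/unitarymxP.
have coordsA (w : 'rV[R]_n) i : coords (w *m A) 0 i = coords w 0 i * toC (r i).
  rewrite /coords map_mxM AE !mulmxA mulmxtVK //.
  by rewrite mul_mx_diag !mxE.
have [/existsP[i0 ui0] | /existsPn u0] := boolP [exists i, coords (const_mx 1) 0 i != 0].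
  have eig i : coords (const_mx 1) 0 i != 0 -> r i = k.
    move=> ui; have := coordsA (const_mx 1) i; rewrite A1.
    have -> : coords (k *: const_mx 1) 0 i = coords (const_mx 1) 0 i * toC k.
      by rewrite /coords map_mxZ -scalemxAl mxE mulrC.
    by move/(mulfI ui)/complexI.
  have ri0 : c < r i0 by rewrite eig.
  have vi0 : coords v 0 i0 = 0.
    have := dotE v (const_mx 1); rewrite trmx_const v1 mxE (bigD1 i0) //= big1 ?addr0.
      move/esym/eqP; rewrite mulf_eq0 conjC_eq0 (negPf ui0) orbF.
      by move/eqP.
    move=> j; apply: contraNeq; rewrite mulf_eq0 conjC_eq0 negb_or => /andP[_ uj].
    by apply/eqP/uniq_gt => //; rewrite (eig j).
  have toCM x y : toC (x * y) = toC x * toC y by rewrite /toC rmorphM.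
  have lecT x y : (toC x <= toC y) = (x <= y) := lecR x y.
  rewrite -lecT toCM !dotE mulr_sumr; apply: ler_sum => i _.
  rewrite coordsA mulrAC [toC c * _]mulrC.
  have [->|ne] := eqVneq i i0; first by rewrite vi0 !mul0r.
  rewrite ler_wpM2l ?mul_conjC_ge0 // lecT leNgt.
  by apply: contraNN ne => ri; apply/eqP/uniq_gt.
have one0 : const_mx 1 = 0 :> 'rV[R]_n.
  have : coords (const_mx 1) = 0 by apply/rowP => i; rewrite [RHS]mxE; apply/eqP/negPn/u0.
  move/(congr1 (fun M => M *m P)); rewrite mul0mx /coords.
  rewrite -mulmxA -invmx_unitary // mulVmx ?unitarymx_unit // mulmx1.
  by move/rowP => h; apply/rowP => i; have := h i; rewrite !mxE => /complexI.
suff -> : v = 0 by rewrite !mul0mx mxE mulr0.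
by apply/rowP => i; have /rowP/(_ i)/eqP := one0; rewrite !mxE oner_eq0.
Qed.

(** The previous bound applied to n Y - S 1, the projection of Y orthogonally to
    the all-ones vector (scaled by n to avoid a division). *)
Lemma adjacency_quadratic (R : rcfType) (T : finType) (e : rel T) (k : nat) (c : R)
    (Y : T -> R) :
  symmetric e -> regular_graph k e -> (0 < #|T|)%N ->
  c < k%:R -> lambda2 R e <= c ->
  #|T|%:R * (\sum_x \sum_(z | e x z) Y x * Y z) <=
    c * #|T|%:R * (\sum_x Y x ^+ 2) + (k%:R - c) * (\sum_x Y x) ^+ 2.
Proof.
move=> sym_e reg_e n_gt0 ck lam; set n := #|T|; set S := \sum_x Y x.
pose A := adjacency_mx R e; pose o := const_mx 1 : 'rV[R]_n.
pose y := \row_i Y (enum_val i) : 'rV[R]_n.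
have symA : A^T = A by apply/matrixP => i j; rewrite !mxE sym_e.
have sum_enum (F : T -> R) : \sum_x F x = \sum_(i < n) F (enum_val i).
  by rewrite (big_enum_val (A := T)).
have oA : o *m A = k%:R *: o.
  apply/rowP => j; rewrite !mxE mulr1 -(reg_e (enum_val j)).
  rewrite -sum1_card natr_sum (eq_bigl (e (enum_val j))); last by move=> x; rewrite inE.
  rewrite [RHS]big_mkcond sum_enum; apply: eq_bigr => i _.
  by rewrite !mxE mul1r sym_e; case: (e _ _).
have oo : o *m o^T = n%:R%:M.
  apply/matrixP => i j; rewrite !mxE !ord1 eqxx mulr1n.
  by under eq_bigr => l _ do rewrite !mxE mulr1; rewrite sumr_const card_ord.
have yo : y *m o^T = S%:M.
  apply/matrixP => i j; rewrite !mxE !ord1 eqxx mulr1n /S sum_enum.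
  by apply: eq_bigr => l _; rewrite !mxE mulr1.
have oy : o *m y^T = S%:M by rewrite -[LHS]trmxK trmx_mul trmxK yo tr_scalar_mx.
have yAo : y *m A *m o^T = (k%:R * S)%:M.
  rewrite -mulmxA -[A *m _]trmxK trmx_mul trmxK symA oA linearZ /= -scalemxAr yo.
  by rewrite scale_scalar_mx.
pose v := n%:R *: y - S *: o.
have vo : v *m (const_mx 1 : 'cV_n) = 0.
  have <- : o^T = const_mx 1 by rewrite trmx_const.
  rewrite mulmxBl -!scalemxAl yo oo !scale_scalar_mx.
  by rewrite mulrC subrr.
have := lambda2_quadratic symA oA ck lam vo.
have yy : (y *m y^T) 0 0 = \sum_x Y x ^+ 2.
  by rewrite mxE sum_enum; apply: eq_bigr => i _; rewrite !mxE expr2.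
have yAy : (y *m A *m y^T) 0 0 = \sum_x \sum_(z | e x z) Y x * Y z.
  rewrite -mulmxA mxE sum_enum; apply: eq_bigr => i _; rewrite !mxE mulr_sumr.
  rewrite [RHS]big_mkcond sum_enum; apply: eq_bigr => j _; rewrite !mxE.
  by case: (e _ _); rewrite ?mul1r ?mul0r ?mulr0.
have vT : v^T = n%:R *: y^T - S *: o^T by rewrite /v linearB /= !linearZ.
have -> : v *m v^T = n%:R ^+ 2 *: (y *m y^T) - (n%:R * S ^+ 2)%:M.
  rewrite vT /v mulmxBl !mulmxBr -!scalemxAl -!scalemxAr.
  rewrite yo oy oo !scale_scalar_mx !scalerA.
  by move: (y *m y^T) => M; apply/matrixP => i j; rewrite !ord1 !mxE eqxx; ring.
have -> : v *m A *m v^T = n%:R ^+ 2 *: (y *m A *m y^T) - (n%:R * k%:R * S ^+ 2)%:M.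
  rewrite vT /v !mulmxBl !mulmxBr -!scalemxAl -!scalemxAr.
  rewrite oA -!scalemxAl yAo oy oo !scale_scalar_mx !scalerA.
  by move: (y *m A *m y^T) => M; apply/matrixP => i j; rewrite !ord1 !mxE eqxx; ring.
have entryE (M : 'M[R]_1) a b : (a *: M - b%:M) 0 0 = a * M 0 0 - b.
  by rewrite !mxE eqxx.
rewrite !entryE yy yAy => h.
have n0 : 0 < n%:R :> R by rewrite ltr0n.
rewrite -(ler_pM2l n0); lra.
Qed.

Close Scope ring_scope.
Local Open Scope nat_scope.

Definition expanding (T : finType) (e : rel T) : Prop := forall Y : T -> nat,
  10 * #|T| * (\sum_x \sum_(z | e x z) Y x * Y z) <=
    19 * #|T| * (\sum_x Y x ^ 2) + 11 * (\sum_x Y x) ^ 2.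

Lemma lambda2_expanding (R : rcfType) (T : finType) (e : rel T) :
  symmetric e -> regular_graph 3 e -> (lambda2 R e <= 19%:R / 10%:R)%R -> 0 < #|T| ->
  expanding e.
Proof.
move=> sym_e reg_e lam n_gt0 Y.
have ck : (19%:R / 10%:R < 3%:R :> R)%R by lra.
have := adjacency_quadratic (fun x => (Y x)%:R%R) sym_e reg_e n_gt0 ck lam.
have -> : (\sum_x \sum_(z | e x z) (Y x)%:R * (Y z)%:R =
    (\sum_x \sum_(z | e x z) Y x * Y z)%N%:R :> R)%R.
  rewrite natr_sum; apply: eq_bigr => x _; rewrite natr_sum.
  by apply: eq_bigr => z _; rewrite natrM.
have -> : (\sum_x (Y x)%:R ^+ 2 = (\sum_x Y x ^ 2)%N%:R :> R)%R.
  by rewrite natr_sum; apply: eq_bigr => x _; rewrite natrX.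
rewrite -natr_sum -(ler_nat R) !(natrD, natrM, natrX); lra.
Qed.

(** * Pieces of graphs and test vectors *)

(** Pieces of graphs are computed with as lists of adjacency lists on the
    vertices 0, 1, ..., and [size g] is the number of vertices. *)
Definition graph := seq (seq nat).
Notation nbrs g u := (nth [::] g u).

Definition add_edge (g : graph) u v : graph :=
  let g' := set_nth [::] g u (v :: nbrs g u) in
  set_nth [::] g' v (u :: nbrs g' v).

(** The piece [g] is a subgraph of [e], through [phi].  It need not be an induced
    subgraph: edges of [e] between vertices of the piece may be missing. *)
Record placed (T : finType) (e : rel T) (g : graph) (phi : nat -> T) : Prop := Placed {
  placed_lt : forall u v, v \in nbrs g u -> v < size g;
  placed_sym : forall u v, v \in nbrs g u -> u \in nbrs g v;
  placed_uniq : forall u, uniq (nbrs g u);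
  placed_inj : forall u v, u < size g -> v < size g -> phi u = phi v -> u = v;
  placed_edge : forall u v, v \in nbrs g u -> e (phi u) (phi v) }.

Definition vsum (y : seq N) : N := foldr N.add 0%num y.
Fixpoint vdot (y z : seq N) : N :=
  match y, z with
  | a :: y', b :: z' => N.add (N.mul a b) (vdot y' z')
  | _, _ => 0%num
  end.
Definition image_vec (g : graph) (y : seq N) : seq N :=
  [seq vsum [seq nth 0%num y v | v <- row] | row <- g].

(** The failure of the inequality of [expanding] at [y], for the edges of [g] only
    and for [n] vertices; [t] is meant to be [image_vec g y]. *)
Definition violates (n : N) (g : graph) (y t : seq N) : bool :=
  let s := vsum y in
  (size y == size g) &&
  N.ltb (19 * n * vdot y y + 11 * s * s) (10 * n * vdot y t).

Lemma ltb_nat (a b : N) : N.ltb a b -> N.to_nat a < N.to_nat b.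
Proof. by move/N.ltb_lt; lia. Qed.

Lemma to_natD (a b : N) : N.to_nat (N.add a b) = N.to_nat a + N.to_nat b.
Proof. exact: N2Nat.inj_add. Qed.

Lemma to_natM (a b : N) : N.to_nat (N.mul a b) = N.to_nat a * N.to_nat b.
Proof. exact: N2Nat.inj_mul. Qed.

Lemma vsumE y : N.to_nat (vsum y) = \sum_(u < size y) N.to_nat (nth 0%num y u).
Proof.
elim: y => [|a y IH]; first by rewrite big_ord0.
by rewrite /= to_natD IH big_ord_recl.
Qed.

Lemma vdotE y z : size y = size z -> N.to_nat (vdot y z) =
  \sum_(u < size y) N.to_nat (nth 0%num y u) * N.to_nat (nth 0%num z u).
Proof.
elim: y z => [|a y IH] [|b z] //=; first by rewrite big_ord0.
by case=> /IH; rewrite to_natD to_natM big_ord_recl => ->.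
Qed.

Lemma image_vecE g y u : u < size g ->
  N.to_nat (nth 0%num (image_vec g y) u) =
  \sum_(v <- nbrs g u) N.to_nat (nth 0%num y v).
Proof.
move=> ug; rewrite (nth_map [::]) //.
elim: (nbrs g u) => [|v r IH] /=; first by rewrite big_nil.
by rewrite to_natD IH big_cons.
Qed.

Lemma placed_card (T : finType) (e : rel T) g (phi : nat -> T) :
  placed e g phi -> size g <= #|T|.
Proof.
case=> _ _ _ inj _.
rewrite -[size g]card_ord -(@card_imset _ _ (fun i : 'I_(size g) => phi i)) ?max_card //.
by move=> i j /inj; rewrite !ltn_ord => /(_ isT isT)/val_inj.
Qed.

(** Extended by zero, [y] becomes a vector on the whole graph.  Its entries being
    nonnegative, the edges outside the piece only increase its energy, and
    replacing the number of vertices by a smaller [n] weakens the inequality. *)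
Lemma expanding_not_violated (T : finType) (e : rel T) g (phi : nat -> T) n y :
  expanding e -> placed e g phi -> N.to_nat n <= #|T| ->
  violates n g y (image_vec g y) = false.
Proof.
move=> exp_e pl le_n; apply/negP => /andP[/eqP size_y /ltb_nat].
set m := size g in size_y.
have phi_inj : injective (fun i : 'I_m => phi i).
  by move=> i j /(placed_inj pl); rewrite !ltn_ord => /(_ isT isT)/val_inj.
pose yn u := N.to_nat (nth 0%num y u).
pose Y x := if [pick i : 'I_m | phi i == x] is Some i then yn i else 0.
have Yphi u : u < m -> Y (phi u) = yn u.
  move=> um; rewrite /Y; case: pickP => [j /eqP|/(_ (Ordinal um))]; last by rewrite eqxx.
  by move/(placed_inj pl (ltn_ord j) um) ->.
have sumY (H : T -> nat) : (forall x, Y x = 0 -> H x = 0) ->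
    \sum_x H x = \sum_(u < m) H (phi u).
  move=> H0; rewrite (bigID (mem [set phi i | i : 'I_m])) /=.
  rewrite big_imset /=; last by move=> i j _ _; apply: phi_inj.
  rewrite [X in _ + X]big1 ?addn0 //.
  move=> x; rewrite /= => nx; apply: H0; rewrite /Y; case: pickP => // j /eqP jx.
  by rewrite -jx imset_f in nx.
rewrite !(to_natD, to_natM) /= vsumE !vdotE ?size_map ?size_y //.
have -> : \sum_(u < m) N.to_nat (nth 0%num y u) = \sum_x Y x.
  by rewrite sumY //; apply: eq_bigr => u _; rewrite Yphi.
have -> : \sum_(u < m) N.to_nat (nth 0%num y u) * N.to_nat (nth 0%num y u) =
    \sum_x Y x ^ 2.
  rewrite sumY; last by move=> x ->.
  by apply: eq_bigr => u _; rewrite Yphi // -mulnn.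
set E := \sum_(u < m) _ => lt_E.
have leE : E <= \sum_x \sum_(z | e x z) Y x * Y z.
  rewrite (sumY (fun x => \sum_(z | e x z) Y x * Y z)); last first.
    by move=> x ->; rewrite big1.
  apply: leq_sum => u _; rewrite image_vecE // -big_distrr /= Yphi // leq_mul2l.
  apply/orP; right.
  have -> : \sum_(v <- nbrs g u) N.to_nat (nth 0%num y v) =
      \sum_(z in [seq phi v | v <- nbrs g u]) Y z.
    rewrite -big_uniq; last first.
      rewrite map_inj_in_uniq ?(placed_uniq pl) // => a b /(placed_lt pl) am /(placed_lt pl) bm.
      exact: (placed_inj pl).
    by rewrite big_map big_seq [RHS]big_seq; apply: eq_bigr => v /(placed_lt pl) /Yphi.
  rewrite [X in _ <= X]big_mkcond [X in X <= _]big_mkcond; apply: leq_sum => z _ /=.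
  case: ifP => // /mapP[v vu ->]; by rewrite (placed_edge pl).
have := exp_e Y; move: leE lt_E le_n.
move: (\sum_x Y x) (\sum_x Y x ^ 2) (\sum_x _) => S Q E'; move: (N.to_nat n) #|T| => m' n'.
rewrite -!mulnn => h1 h2 h3 h4.
(* If 10 E <= 19 Q the inequality holds for any number of vertices. *)
have h5 : 19 * m' * Q + 11 * (S * S) < 10 * m' * E' by nia.
have h6 : 19 * Q < 10 * E' by nia.
have : m' * (10 * E' - 19 * Q) <= n' * (10 * E' - 19 * Q) by rewrite leq_mul2r h3 orbT.
by nia.
Qed.

(** * The search and its soundness *)

(** One step of power iteration for I + A_g - (1.1 / n) J, the entries being cut
    at zero by the truncated subtraction of [N]; here [t] is the image of [y] and
    [c] approximates 1.1 / n times the sum of [y]. *)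
Fixpoint step_vec (c : N) (y t : seq N) : seq N :=
  match y, t with
  | a :: y', b :: t' => N.sub (N.add a b) c :: step_vec c y' t'
  | _, _ => [::]
  end.

(** Ten significant bits are enough for the vectors met below, and keep the
    arithmetic cheap. *)
Definition halve (y : seq N) :=
  if has (N.ltb 1023) y then [seq N.div2 a | a <- y] else y.

(** Power iteration is only a heuristic: what matters is that a vector that
    violates the bound is produced when the answer is [true].  The last vector is
    also returned, to start from it on the next larger piece. *)
Fixpoint refute k n g y : bool * seq N :=
  let t := image_vec g y in
  if violates n g y t then (true, y) else
  if k is k'.+1 then
    refute k' n g (halve (halve (step_vec (N.div (11 * vsum y) (10 * n)) y t)))
  else (false, y).

Lemma refuteP k n g y : (refute k n g y).1 ->
  exists y', violates n g y' (image_vec g y').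
Proof.
elim: k y => [|k IH] y /=; case: ifP => //; first by exists y.
  by exists y.
by move=> _ /IH.
Qed.

(* Simplification would unfold the rounds symbolically. *)
Arguments refute : simpl never.

Definition spread (g : graph) (b : seq bool) : seq bool :=
  [seq p.1 || has (nth false b) p.2 | p <- zip b g].

(** The vertices at distance at most [k] from [u] in [g], as a characteristic
    vector. *)
Definition ball k (g : graph) u := iter k (spread g) (mkseq (pred1 u) (size g)).

(** The vertices of [g] to be tried as the next neighbour of [u], among those from
    [lo] on.  A vertex of full degree is impossible, and so is one in the ball
    around [u], as it would close a short cycle.  Two vertices with the same
    neighbours in [g] can be exchanged, so that only the first of them needs to
    be tried; this symmetry breaking divides the size of the search by
    a large factor. *)
Definition candidates k (g : graph) u lo : seq nat :=
  let b := ball k g u in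
  [seq w <- iota lo (size g - lo) |
   [&& size (nbrs g w) < 3, ~~ nth false b w &
     ~~ has (fun w' => (w' != u) && (nbrs g w' == nbrs g w)) (iota lo (w - lo))]].

(** The vertex whose neighbours are completed next.  Any choice would be correct;
    vertices that miss a single neighbour branch the least. *)
Definition deficient (g : graph) : nat :=
  if has (fun r => size r == 2) g then find (fun r => size r == 2) g
  else find (fun r => size r < 3) g.

(** The current piece is [g].  While the neighbours of [cur] are incomplete, each
    branch adds one of them, either a candidate or a new vertex numbered
    [size g]; the vertices before [lo] that are not yet neighbours of [cur] are
    known not to be, having been tried in other branches.  Recursive calls are
    guarded by conditionals, since both arguments of a boolean operator are
    evaluated under call by value. *)
Fixpoint search (accept : graph -> bool) k fuel g y cur lo : bool :=
  let n := N.max 18 (N.of_nat (size g)) in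
  let: (refuted, y') := refute 8 n g y in
  if refuted then true else
  if fuel is fuel'.+1 then
    let: (u, lo') :=
      if size (nbrs g cur) < 3 then (cur, lo) else (deficient g, 0) in
    if (u < size g) && (size (nbrs g u) < 3) then
      if all (fun w => search accept k fuel' (add_edge g u w) y' u w.+1)
           (candidates k g u lo') then
        search accept k fuel' (add_edge g u (size g)) (rcons y' 1%num) u (size g).+1
      else false
    else if all (fun r => 3 <= size r) g then
      (* Some closed graphs violate the bound by a narrow margin only. *)
      if (refute 60 n g y').1 then true else accept g
    else false
  else false.

Lemma size_add_edge g u w : u < size g ->
  size (add_edge g u w) = maxn w.+1 (size g).
Proof. by move=> ug; rewrite !size_set_nth (maxn_idPr ug). Qed.

Lemma mem_add_edge g u w a b : u != w ->
  (b \in nbrs (add_edge g u w) a) =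
  [|| b \in nbrs g a, (a == u) && (b == w) | (a == w) && (b == u)].
Proof.
move=> uw; rewrite /add_edge !nth_set_nth /= ![w == u]eq_sym (negPf uw) nth_set_nth /=.
have [->|aw] := eqVneq a w.
  by rewrite eq_sym (negPf uw) in_cons /= orbC.
by have [->|au] := eqVneq a u; rewrite ?in_cons /= ?orbF // orbC.
Qed.

Section Placements.
Variables (T : finType) (e : rel T).
Hypotheses (sym_e : symmetric e) (irr_e : irreflexive e) (reg_e : regular_graph 3 e).

Lemma placed_eq g phi psi : (forall u, u < size g -> phi u = psi u) ->
  placed e g phi -> placed e g psi.
Proof.
move=> E [lt sy un inj ed]; split => // [u v um vm|u v vu].
  by rewrite -!E //; apply: inj.
by rewrite -!E ?ed //; [apply: lt vu|apply: lt (sy _ _ vu)].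
Qed.

Lemma placed_add_edge g phi u w : placed e g phi -> u < size g -> w <= size g ->
  w \notin nbrs g u -> e (phi u) (phi w) ->
  (forall v, v < size g -> v != w -> phi v != phi w) ->
  placed e (add_edge g u w) phi.
Proof.
move=> [lt sy un inj ed] um wm wu euw new_w.
have uw : u != w by apply: contraTneq euw => ->; rewrite irr_e.
have sz := size_add_edge w um.
split.
- move=> a b; rewrite mem_add_edge // sz => /or3P[/lt bm|/andP[_ /eqP->]|/andP[_ /eqP->]];
  by rewrite leq_max ?bm ?um ?leqnn ?orbT.
- move=> a b; rewrite !mem_add_edge // => /or3P[/sy ->//||] /andP[-> ->];
  by rewrite !orbT.
- move=> a; rewrite /add_edge nth_set_nth /= nth_set_nth /= [w == u]eq_sym (negPf uw).
  case: eqP => [_|_].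
    rewrite /= un andbT; apply: contraNN wu; exact: sy.
  by rewrite nth_set_nth /=; case: eqP => [_|_] //=; rewrite un andbT.
- have new_w' v : v < size g -> phi v = phi w -> v = w.
    by move=> vm E; apply/eqP; apply: contraTT isT => /(new_w _ vm); rewrite E eqxx.
  move=> a b; rewrite sz !leq_max !ltnS.
  have [am|am] := ltnP a (size g); have [bm|bm] := ltnP b (size g).
  + by move=> _ _; apply: inj.
  + rewrite orbF orbT => _ bw; have -> : b = w by apply/eqP; rewrite eqn_leq bw (leq_trans wm).
    exact: new_w'.
  + rewrite orbF => aw _; have -> : a = w by apply/eqP; rewrite eqn_leq aw (leq_trans wm).
    by move=> /esym /new_w' ->.
  + rewrite !orbF => aw bw _; apply/eqP; rewrite eqn_leq.
    by rewrite (leq_trans aw) ?(leq_trans wm) // (leq_trans bw) ?(leq_trans wm).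
- move=> a b; rewrite mem_add_edge // => /or3P[/ed //||] /andP[/eqP-> /eqP->] //.
  by rewrite sym_e.
Qed.

Definition swap (w w' a : nat) := if a == w then w' else if a == w' then w else a.

(** Exchanging two vertices with the same neighbours is an automorphism. *)
Lemma placed_swap g phi w w' : placed e g phi -> w < size g -> w' < size g ->
  nbrs g w = nbrs g w' -> placed e g (phi \o swap w w').
Proof.
move=> [lt sy un inj ed] wm wm' row_eq.
have swap_lt a : a < size g -> swap w w' a < size g.
  by rewrite /swap; case: eqP => // _; case: eqP.
have swap_inj : injective (swap w w').
  move=> a b; rewrite /swap.
  by case: (a =P w); case: (b =P w); case: (a =P w'); case: (b =P w'); congruence.
have swap_row a : nbrs g (swap w w' a) = nbrs g a.
  by rewrite /swap; case: eqP => [->|_] //; case: eqP => [->|].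
split => // [u v um vm /= /inj h|u v vu].
  by apply: swap_inj; apply: h; apply: swap_lt.
by apply: ed; rewrite swap_row; apply/sy; rewrite swap_row; apply/sy.
Qed.

Definition decided phi g u lo :=
  forall w, w < lo -> w < size g -> e (phi u) (phi w) -> w \in nbrs g u.

Definition deleted x y : rel T := fun a b =>
  [&& e a b, (a, b) != (x, y) & (a, b) != (y, x)].

(** All cycles have length at least [k + 2]: the ends of an edge are at distance
    more than [k] once the edge is deleted.  This form speaks of walks
    rather than of cycles without repetition, and is the one that a
    breadth-first search in a piece contradicts. *)
Definition long_cycles k := forall x y p, e x y ->
  path (deleted x y) x p -> last x p = y -> k < size p.

Lemma ballP g phi k u w : placed e g phi -> nth false (ball k g u) w ->
  exists p, [/\ path (fun a b => b \in nbrs g a) u p, last u p = w & size p <= k].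
Proof.
move=> pl; elim: k w => [|k IH] w.
  have [wm|wm] := ltnP w (size g); last by rewrite nth_default // size_mkseq.
  by rewrite nth_mkseq //= => /eqP ->; exists [::].
rewrite /ball iterS -/(ball k g u) /spread.
set b := ball k g u in IH *.
have [wm|wm] := ltnP w (size (zip b g)); last by rewrite nth_default // size_map.
rewrite (nth_map (false, [::])) // nth_zip_cond wm /= => /orP[/IH[p [h1 h2 h3]]|].
  by exists p; split => //; apply: leqW.
case/hasP => v vw /IH [p [h1 h2 h3]]; exists (rcons p w).
by rewrite rcons_path h1 h2 last_rcons size_rcons ltnS h3 (placed_sym pl).
Qed.

Lemma long_cycles_ball g phi k u w : placed e g phi -> long_cycles k ->
  u < size g -> w < size g -> w \notin nbrs g u -> e (phi u) (phi w) ->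
  nth false (ball k g u) w = false.
Proof.
move=> pl long um wm wu euw; apply/negP => /(ballP pl)[p [path_p last_p]].
apply/negP; rewrite -ltnNge -(size_map phi); apply: (long _ _ _ euw); last first.
  by rewrite last_map last_p.
rewrite path_map; move: path_p; apply: sub_in_path (all_predT _) => //.
move=> a b _ _ ba; rewrite /deleted /= (placed_edge pl) //=.
have bm := placed_lt pl ba; have am := placed_lt pl (placed_sym pl ba).
apply/andP; split; apply/eqP => -[/(placed_inj pl) Ea /(placed_inj pl) Eb].
  by move: ba wu; rewrite Ea // Eb // => ->.
by move: ba wu; rewrite Ea // Eb // => /(placed_sym pl) ->.
Qed.

Lemma full_nbrs g phi u x : placed e g phi -> u < size g -> 3 <= size (nbrs g u) ->
  e (phi u) x -> exists2 v, v \in nbrs g u & x = phi v.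
Proof.
move=> pl um full ex; apply/mapP.
have uniq_map : uniq [seq phi v | v <- nbrs g u].
  rewrite map_inj_in_uniq ?(placed_uniq pl) // => a b /(placed_lt pl) am /(placed_lt pl) bm.
  exact: (placed_inj pl).
have sub : {subset [seq phi v | v <- nbrs g u] <= enum [set y | e (phi u) y]}.
  by move=> y /mapP[v vu ->]; rewrite mem_enum inE (placed_edge pl).
have size_le : size (enum [set y | e (phi u) y]) <= size [seq phi v | v <- nbrs g u].
  by rewrite size_map -cardE reg_e.
have [_ ->] := uniq_min_size uniq_map sub size_le.
by rewrite mem_enum inE.
Qed.

Hypotheses (exp_e : expanding e) (large : 18 <= #|T|).
Variables (k : nat) (accept : graph -> bool) (goal : Prop).
Hypothesis long : long_cycles k.
Hypothesis acceptP : forall g phi, placed e g phi ->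
  all (fun r => 3 <= size r) g -> accept g -> goal.

Lemma not_refuted g phi m y : placed e g phi ->
  (refute m (N.max 18 (N.of_nat (size g))) g y).1 = false.
Proof.
move=> pl; apply/negP => /refuteP[y']; rewrite (expanding_not_violated y' exp_e pl) //.
by have := placed_card pl; move: large; lia.
Qed.

(** Suppose that the piece [g] is placed in [e] by [phi] and that [u] misses a
    neighbour.  If some missing neighbour belongs to the piece, take, among
    all the placements of [g] that agree with what is decided, one where the
    first missing neighbour [w] has the least number.  Then [w] is a
    candidate: were it skipped for an earlier vertex with the same neighbours,
    exchanging the two would give a smaller number.  Otherwise the missing
    neighbour is a new vertex. *)
Lemma search_sound fuel g y cur lo phi : search accept k fuel g y cur lo ->
  placed e g phi -> decided phi g cur lo -> goal.
Proof.
elim: fuel g y cur lo phi => [|fuel IH] g y cur lo phi /=; set m := N.max _ _;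
  case refE : (refute 8 m g y) => [refuted y'] srch pl dec.
  by move: srch; have := not_refuted 8 y pl; rewrite refE /= => ->.
move: srch; have := not_refuted 8 y pl; rewrite refE /= => ->.
set choice := if _ then _ else _.
have : decided phi g choice.1 choice.2 by rewrite /choice; case: ifP.
case: choice => u lo' /= {}dec.
case: ifP => [/andP[um u3]|_]; last first.
  by case: ifP => // full; rewrite (not_refuted 60 y' pl); apply: acceptP pl full.
case: ifP => // /allP branch new_branch.
(* Strong induction on [w], over all placements, realizes the minimal choice. *)
have old_nbr w psi : placed e g psi -> decided psi g u lo' -> w < size g ->
    w \notin nbrs g u -> e (psi u) (psi w) -> goal.
  elim/ltn_ind: w psi => w IHw psi pl' dec' wm wu euw.
  have [/hasP[w' + /andP[wu' euw']]|/hasPn least] :=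
      boolP (has (fun w' => (w' \notin nbrs g u) && e (psi u) (psi w')) (iota 0 w)).
    rewrite mem_iota /= => ww'; apply: (IHw _ ww' psi) => //; exact: ltn_trans wm.
  have [/branch srch|] := boolP (w \in candidates k g u lo').
    apply: (IH _ _ _ _ psi srch).
      apply: placed_add_edge => //; first exact: ltnW.
      by move=> v vm; apply: contraNneq => /(placed_inj pl' vm wm) ->.
    have uw : u != w by apply: contraTneq euw => ->; rewrite irr_e.
    move=> v; rewrite ltnS size_add_edge // (maxn_idPr wm) mem_add_edge // => vw vm euv.
    move: vw; rewrite leq_eqVlt => /orP[/eqP->|vw]; first by rewrite !eqxx orbT.
    have := least v; rewrite mem_iota euv andbT negbK /= => -> //.
  have low : lo' <= w by rewrite leqNgt; apply: contraNN wu => wlo; apply: dec'.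
  rewrite mem_filter mem_iota low subnKC ?wm ?(leq_trans low) ?andbT //; last exact: ltnW.
  rewrite (long_cycles_ball pl' long) //= negb_and negbK -leqNgt => /orP[full|].
    rewrite sym_e in euw; have [v vw /(placed_inj pl' um) E] := full_nbrs pl' wm full euw.
    by move: wu; rewrite (placed_sym pl') // E // (placed_lt pl' vw).
  case/hasP => w'; rewrite mem_iota subnKC // => /andP[low' ww'] /andP[wu' /eqP rowE].
  have wm' := ltn_trans ww' wm.
  have uw : (u == w) = false by apply: contraTF euw => /eqP ->; rewrite irr_e.
  have u_fix : swap w w' u = u by rewrite /swap uw eq_sym (negPf wu').
  apply: (IHw w' ww' (psi \o swap w w')) => //.
  - exact: placed_swap.
  - move=> v vlo vm; rewrite /= u_fix.
    rewrite {1}/swap (ltn_eqF (leq_trans vlo low)) (ltn_eqF (leq_trans vlo low')).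
    exact: dec'.
  - apply: contraNN wu => /(placed_sym pl'); rewrite rowE; exact: (placed_sym pl').
  - by rewrite /= u_fix /swap (ltn_eqF ww') eqxx.
have [x ex nx] : exists2 x, e (phi u) x & x \notin [seq phi v | v <- nbrs g u].
  apply/exists_inP; apply: contraLR u3 => /exists_inPn h; rewrite -leqNgt.
  rewrite -(reg_e (phi u)) -(size_map phi) cardE; apply: uniq_leq_size (enum_uniq _) _ => y0.
  by rewrite mem_enum inE => /h; rewrite negbK.
have [/existsP[w /eqP xw]|/existsPn fresh] := boolP [exists w : 'I_(size g), x == phi w].
  apply: (old_nbr w phi) => //; first by apply: contraNN nx => wu; rewrite xw map_f.
  by rewrite -xw.
pose psi v := if v == size g then x else phi v.
have psiE v : v < size g -> psi v = phi v by move=> vm; rewrite /psi ltn_eqF.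
have psi_new : psi (size g) = x by rewrite /psi eqxx.
have [/existsP[w /andP[wu euw]]|/existsPn old] :=
    boolP [exists w : 'I_(size g), ((w : nat) \notin nbrs g u) && e (phi u) (phi w)].
  exact: (old_nbr w phi).
have um' : u != size g by rewrite ltn_eqF.
apply: (IH _ _ _ _ psi new_branch).
  apply: placed_add_edge => //; first by apply: placed_eq pl => v /psiE.
  - by apply/negP => /(placed_lt pl); rewrite ltnn.
  - by rewrite psi_new psiE.
  - by move=> v vm _; rewrite psi_new psiE // eq_sym; apply: (fresh (Ordinal vm)).
move=> v; rewrite ltnS leq_eqVlt mem_add_edge // => /orP[/eqP-> *|vm _].
  by rewrite !eqxx orbT.
rewrite !psiE // => euv; have := old (Ordinal vm); rewrite /= euv andbT negbK => -> //.
Qed.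
End Placements.

(** * The Pappus graph and the graph Y *)

Definition adjacency (U : eqType) (e : rel U) (us : seq U) : graph :=
  [seq [seq j <- iota 0 (size us) | e u (nth u us j)] | u <- us].

(** The two target graphs are also tabulated, for fast comparison. *)
Definition pappus_vertices : seq 'Z_(size pappus_code) := mkseq inZp 18.
Definition Y_vertices : seq Yvertex :=
  let zs := [:: 0; 1; 2%:R]%R in
  [:: Yc1; Yc2; Yc3] ++ map Yp zs ++ map Yq zs ++ map Yr zs ++ map Yy zs ++ map Yz zs.

Definition pappus_graph : graph := Eval vm_compute in adjacency pappus_rel pappus_vertices.
Definition Y_graph : graph := Eval vm_compute in adjacency Y_rel Y_vertices.

Lemma pappus_graphE : adjacency pappus_rel pappus_vertices = pappus_graph.
Proof. by vm_compute. Qed.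

Lemma Y_graphE : adjacency Y_rel Y_vertices = Y_graph.
Proof. by vm_compute. Qed.

Lemma mem_pappus_vertices u : u \in pappus_vertices.
Proof.
apply/mapP; exists (val u); first by rewrite mem_iota /=; exact: ltn_ord.
by apply: val_inj; rewrite /= modn_small //; exact: ltn_ord.
Qed.

Lemma mem_Y_vertices u : u \in Y_vertices.
Proof.
suff [i i18 <-] : exists2 i, i < 18 & nth Yc1 Y_vertices i = u by apply: mem_nth.
have Z3 (i : 'Z_3) : [\/ i = 0, i = 1 | i = 2%:R]%R.
  case: i => -[|[|[|//]]] lt; [constructor 1|constructor 2|constructor 3]; exact: val_inj.
case: u => [|||i|i|i|i|i]; [by exists 0|by exists 1|by exists 2|..]; case: (Z3 i) => ->;
  [exists 3|exists 4|exists 5|exists 6|exists 7|exists 8|exists 9|exists 10|exists 11|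
   exists 12|exists 13|exists 14|exists 15|exists 16|exists 17]; reflexivity.
Qed.

Lemma uniq_pappus_vertices : uniq pappus_vertices.
Proof. by rewrite -(map_inj_uniq val_inj). Qed.

(** Equality of [Yvertex] goes through [inord], which does not compute; a
    numbering of the vertices does. *)
Lemma uniq_Y_vertices : uniq Y_vertices.
Proof.
pose rank u : nat := match u with
  | Yc1 => 0 | Yc2 => 1 | Yc3 => 2
  | Yp i => 3 + i | Yq i => 6 + i | Yr i => 9 + i | Yy i => 12 + i | Yz i => 15 + i
  end.
by apply: (@map_uniq _ _ rank).
Qed.

(** Depth-first search for an isomorphism from [g] to [r], where [pi] lists the
    images of the first vertices.  The next vertex is sent to a neighbour of the
    image of one of its earlier neighbours, if it has any.  The answer is
    empty on failure; its correctness is tested afterwards by [is_copy]. *)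
Fixpoint extend_copy fuel (r g : graph) (pi : seq nat) : seq nat :=
  if fuel is fuel'.+1 then
    let i := size pi in
    (fix first cs :=
       if cs is c :: cs' then
         if if c \in pi then false else
            all (fun j => (j \in nbrs g i) == (nth 0 pi j \in nbrs r c)) (iota 0 i)
         then if extend_copy fuel' r g (rcons pi c) is d :: pi' then d :: pi' else first cs'
         else first cs'
       else [::])
    (if [seq j <- nbrs g i | j < i] is j :: _ then nbrs r (nth 0 pi j) else iota 0 (size g))
  else pi.

Definition is_copy (r g : graph) (pi : seq nat) : bool :=
  let ids := iota 0 (size g) in
  [&& size r == size g, size pi == size g, uniq pi,
      all (fun c => c < size g) pi &
      all (fun a => all (fun b =>
        (nth 0 pi b \in nbrs r (nth 0 pi a)) == (b \in nbrs g a)) ids) ids].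

Definition known (g : graph) : bool :=
  if is_copy Y_graph g (extend_copy (size g) Y_graph g [::]) then true
  else is_copy pappus_graph g (extend_copy (size g) pappus_graph g [::]).

(** * Evaluation of the searches *)

Definition cycle_graph n : graph :=
  mkseq (fun i => [:: if i.+1 == n then 0 else i.+1; if i == 0 then n.-1 else i.-1]) n.

(** The fuel bounds the number of edges added along a branch; a search that runs
    out of it answers [false]. *)
Notation exhausted accept k g :=
  (search accept k 60 g (nseq (size g) 1%num) 0 0).

(** The girth bound of each search is the one that the previous searches
    establish. *)
Lemma exhausted_triangle : exhausted known 1 (cycle_graph 3).
Proof. by vm_compute. Qed.

Lemma exhausted_square : exhausted known 2 (cycle_graph 4).
Proof. by vm_compute. Qed.

Lemma exhausted_pentagon : exhausted known 3 (cycle_graph 5).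
Proof. by vm_compute. Qed.

Lemma exhausted_hexagon : exhausted known 4 (cycle_graph 6).
Proof. by vm_compute. Qed.

Lemma exhausted_vertex : exhausted known 5 ([:: [::]] : graph).
Proof. by vm_compute. Qed.

(** * The classification *)

Section Conclusion.
Variables (T : finType) (e : rel T).
Hypotheses (sym_e : symmetric e) (irr_e : irreflexive e) (reg_e : regular_graph 3 e).

(** No edge leaves the image of a piece all of whose vertices have degree 3. *)
Lemma closed_piece_spans g (phi : nat -> T) : connected_graph e -> placed e g phi ->
  all (fun r => 3 <= size r) g -> 0 < size g ->
  forall x, x \in mkseq phi (size g).
Proof.
move=> [_ conn] pl /allP full g_gt0.
have closed_image : closed e (mem (mkseq phi (size g))).
  apply: (intro_closed (sym_connect_sym sym_e)) => x y exy /mapP[u].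
  rewrite mem_iota /= add0n => um xE.
  have [||v vu ->] := full_nbrs reg_e pl um _ (x := y); rewrite -?xE //.
    by apply: full; apply: mem_nth.
  by apply: map_f; rewrite mem_iota (placed_lt pl vu).
move=> x; have <- := closed_connect closed_image (conn (phi 0) x).
by apply: map_f; rewrite mem_iota.
Qed.

(** As [g] is closed, its non-edges are non-edges of [e], so that the comparison
    of [g] with the table of [e'] decides adjacency in both directions. *)
Lemma copy_iso (U : finType) (e' : rel U) (us : seq U) g pi (phi : nat -> T) :
  connected_graph e -> placed e g phi -> all (fun r => 3 <= size r) g -> 0 < size g ->
  uniq us -> (forall u, u \in us) -> is_copy (adjacency e' us) g pi -> graph_iso e e'.
Proof.
move=> conn pl full g_gt0 uniq_us mem_us.
case/and5P; rewrite size_map => /eqP size_us /eqP size_pi uniq_pi /allP pi_lt /allP copy.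
have mem_phi := closed_piece_spans conn pl full g_gt0.
have uniq_phi : uniq (mkseq phi (size g)).
  rewrite map_inj_in_uniq ?iota_uniq // => a b; rewrite !mem_iota /= => am bm.
  exact: (placed_inj pl).
have [u0 _] : exists u0 : U, True.
  by case: us size_us {mem_us uniq_us copy} => [g0|u ? _]; [rewrite -g0 in g_gt0|exists u].
pose idx x := index x (mkseq phi (size g)).
have idx_lt x : idx x < size g by rewrite /idx -[X in _ < X](size_mkseq phi) index_mem.
have phi_idx x : phi (idx x) = x.
  by rewrite -[RHS](nth_index x (mem_phi x)) nth_mkseq // -/(idx x).
have pi_idx x : nth 0 pi (idx x) < size g by apply: pi_lt; rewrite mem_nth ?size_pi.
exists (fun x => nth u0 us (nth 0 pi (idx x))); split; last first.
  move=> x y.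
  have := copy (idx x); rewrite mem_iota /= idx_lt => /(_ isT)/allP/(_ (idx y)).
  rewrite mem_iota /= idx_lt => /(_ isT)/eqP.
  rewrite /adjacency (nth_map u0) ?size_us //.
  rewrite mem_filter mem_iota /= pi_idx andbT.
  rewrite [nth (nth _ _ _) us _](set_nth_default u0) ?size_us // => ->.
  rewrite -{2}(phi_idx x) -{2}(phi_idx y).
  apply/idP/idP => [/(placed_edge pl)//|].
  have full_x : 3 <= size (nbrs g (idx x)) by apply: (allP full); apply: mem_nth.
  move=> /(full_nbrs reg_e pl (idx_lt x) full_x) [v vx /(placed_inj pl (idx_lt y)) -> //].
  exact: (placed_lt pl vx).
have cardU : #|U| = size g.
  rewrite -size_us -(card_uniqP uniq_us); apply/esym/eq_card => u; exact: mem_us.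
have cardT' : #|T| = size g.
  rewrite -(size_mkseq phi (size g)) -(card_uniqP uniq_phi).
  by apply/esym/eq_card => x; apply: mem_phi.
apply: inj_card_bij; last by rewrite cardU cardT'.
move=> x y /(congr1 (index^~ us)); rewrite !index_uniq ?size_us //.
move=> /(congr1 (index^~ pi)); rewrite !index_uniq ?size_pi // => E.
by rewrite -(phi_idx x) E phi_idx.
Qed.

Lemma known_iso g (phi : nat -> T) : connected_graph e -> placed e g phi ->
  all (fun r => 3 <= size r) g -> known g ->
  graph_iso e pappus_rel \/ graph_iso e Y_rel.
Proof.
move=> conn pl full.
have copy_gt0 r pi : is_copy r g pi -> 0 < size r -> 0 < size g.
  by case/and5P => /eqP ->.
rewrite /known; case: ifP => [copy _|_ copy].
  have g_gt0 := copy_gt0 _ _ copy isT.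
  right; rewrite -Y_graphE in copy.
  exact: copy_iso conn pl full g_gt0 uniq_Y_vertices mem_Y_vertices copy.
have g_gt0 := copy_gt0 _ _ copy isT.
left; rewrite -pappus_graphE in copy.
exact: copy_iso conn pl full g_gt0 uniq_pappus_vertices mem_pappus_vertices copy.
Qed.

(** A shortest path between the ends of a deleted edge closes to a cycle without
    repetition.  The alternative is stated with an arbitrary conclusion so
    as to chain over increasing lengths. *)
Lemma cycle_or_long k (goal : Prop) : 0 < k -> long_cycles e k ->
  (forall phi, placed e (cycle_graph k.+2) phi -> goal) ->
  (long_cycles e k.+1 -> goal) -> goal.
Proof.
move=> k_gt0 long cyc_goal long_goal.
pose bad x (p : seq T) := e x (last x p) && path (deleted e x (last x p)) x p.
have [/existsP[x /existsP[p /andP[exy path_p]]]|/existsPn none] :=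
    boolP [exists x, exists p : k.+1.-tuple T, bad x p]; last first.
  apply: long_goal => x y p exy path_p last_p; rewrite ltn_neqAle (long x y) // andbT.
  apply/eqP => size_p; have := none x; apply/negP/negPn/existsP.
  by exists (Tuple (introT eqP (esym size_p))); rewrite /bad /= last_p exy path_p.
move: exy path_p; move lastE: (last x p) => y exy path_p.
case/shortenP: path_p lastE (size_tuple p) => p' path_p' uniq_p' sub_p' lastE size_p.
have size_p' : size p' = k.+1.
  apply/eqP; rewrite eqn_leq (long _ _ _ exy path_p' lastE) andbT -size_p.
  by apply: uniq_leq_size sub_p'; case/andP: uniq_p'.
apply: (cyc_goal (nth x (x :: p'))).
set psi := nth x _.
have step i : i < k.+1 -> e (psi i) (psi i.+1).
  by rewrite -size_p' => ip; have /(pathP x)/(_ _ ip)/andP[] := path_p'.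
have close : e (psi 0) (psi k.+1).
  by rewrite /psi -size_p' -[size p']/(size (x :: p')).-1 nth_last /= lastE.
have nbrsE u v : (v \in nbrs (cycle_graph k.+2) u) =
    (u < k.+2) && ((v == if u.+1 == k.+2 then 0 else u.+1) ||
                   (v == if u == 0 then k.+1 else u.-1)).
  have [uk|uk] := ltnP u k.+2; last by rewrite nth_default ?size_mkseq.
  by rewrite nth_mkseq // !inE.
split.
- by move=> u v; rewrite nbrsE size_mkseq; do 2!(case: ifP => /eqP ?); lia.
- by move=> u v; rewrite !nbrsE; do 4!(case: ifP => /eqP ?); lia.
- move=> u; have [uk|uk] := ltnP u k.+2; last by rewrite nth_default ?size_mkseq.
  by rewrite nth_mkseq //= inE andbT; do 2!(case: ifP => /eqP ?); lia.
- move=> u v; rewrite size_mkseq => uk vk /eqP.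
  by rewrite nth_uniq ?size_p' //= ?size_p' // => /eqP.
move=> u v; rewrite nbrsE => /andP[uk /orP[] /eqP ->]; case: eqP => E.
- by move: E => [->]; rewrite sym_e.
- by apply: step; lia.
- by rewrite E.
by rewrite sym_e -{2}(@prednK u); [apply: step|]; lia.
Qed.

Lemma long_cycles1 : long_cycles e 1.
Proof.
move=> x y [|z [|//]] exy /=; first by move=> _ xy; rewrite xy irr_e in exy.
by move=> /andP[/and3P[_ nxy _] _] zy; rewrite zy eqxx in nxy.
Qed.
End Conclusion.

Lemma cubic_expanding_classification (T : finType) (e : rel T) :
  symmetric e -> irreflexive e -> connected_graph e -> regular_graph 3 e ->
  expanding e -> 18 <= #|T| -> graph_iso e pappus_rel \/ graph_iso e Y_rel.
Proof.
move=> sym_e irr_e conn reg_e exp_e large.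
have search_run k g (phi : nat -> T) : exhausted known k g -> long_cycles e k ->
    placed e g phi -> graph_iso e pappus_rel \/ graph_iso e Y_rel.
  move=> run long pl.
  apply: (search_sound sym_e irr_e reg_e exp_e large long _ run pl) => // g' psi pl' full'.
  exact: known_iso pl' full'.
apply: (cycle_or_long sym_e _ (long_cycles1 irr_e)) => [//|phi pl|long2].
  exact: search_run exhausted_triangle (long_cycles1 irr_e) pl.
apply: (cycle_or_long sym_e _ long2) => [//|phi pl|long3].
  exact: search_run exhausted_square long2 pl.
apply: (cycle_or_long sym_e _ long3) => [//|phi pl|long4].
  exact: search_run exhausted_pentagon long3 pl.
apply: (cycle_or_long sym_e _ long4) => [//|phi pl|long5].
  exact: search_run exhausted_hexagon long4 pl.
have [x _] : exists x : T, x \in T by apply/card_gt0P; apply: leq_trans large.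
apply: (search_run _ _ (fun=> x) exhausted_vertex long5).
by split => [u v|u v|u|[|u] [|v]|u v] //; case: u => [|[|u]].
Qed.

Local Open Scope ring_scope.

Theorem proposition4p7 (R : rcfType) (T : finType) (e : rel T)
    (e_sym : symmetric e) (e_irr : irreflexive e)
    (e_conn : connected_graph e) (e_reg : regular_graph 3 e)
    (e_lambda2 : lambda2 R e <= 19%:R / 10%:R) :
  (#|T| <= 18)%N /\
  (#|T| = 18%N <-> graph_iso e pappus_rel \/ graph_iso e Y_rel).
Proof.
have exp_e := lambda2_expanding e_sym e_reg e_lambda2 (proj1 e_conn).
have classify := cubic_expanding_classification e_sym e_irr e_conn e_reg exp_e.
have iso18 : graph_iso e pappus_rel \/ graph_iso e Y_rel -> #|T| = 18%N.
  case=> -[f [/bij_eq_card -> _]].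
    by rewrite card_ord.
  rewrite -[RHS]/(size Y_vertices) -(card_uniqP uniq_Y_vertices).
  by apply: eq_card => u; rewrite mem_Y_vertices.
split; last by split=> // n18; apply: classify; rewrite n18.
by rewrite leqNgt; apply/negP => lt18; have := iso18 (classify (ltnW lt18)); lia.
Qed.
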